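(* Let $(T,d,\rho)$ be a rooted compact real tree and let $\leq$ be a linear order on $T$ satisfying (Or1) and (Or2). Let $\mu$ and $\mu'$ be two finite Borel measures on $T$ that both satisfy (Mes). Let $h$ (resp. $h'$) be the unique element of $\mathcal{H}$ satisfying (Min) such that $(T_h,d_h,\rho_h,\leq_h,\mu_h)$ is equivalent to $(T,d,\rho,\leq,\mu)$ (resp. $(T_{h'},d_{h'},\rho_{h'},\leq_{h'},\mu_{h'})$ is equivalent to $(T,d,\rho,\leq,\mu')$). Then there exists a non-decreasing and left-continuous mapping $\varphi:[0,\mu(T)]\to[0,\infty)$ such that $$\varphi(0)=0\quad\text{and}\quad h=h'\circ\varphi$$ (the latter identity including that $\varphi$ takes its values in $[0,\zeta(h')]$). Moreover, for such time-changes $\varphi$ the following assertions are true: (i) The time-change $\varphi$ is unique if and only if for every $\sigma\in T$, $\mu(\{\sigma\})\,\mu'(\{\sigma\})=0$, i.e. $\mu$ and $\mu'$ do not share any atom. (ii) If $\mu'$ has no atom, then $\varphi$ is continuous. (iii) If $\mu$ has no atom, then $\varphi$ is (strictly) increasing. (iv) For any $t\in[0,\zeta(h))$ such that $\varphi(t)<\varphi(t+)$, $$h'(u)=h(t),\quad u\in[\varphi(t),\varphi(t+)].$$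
   Context: **Real trees.** A metric space $(T,d)$ is a real tree if: (1) for all $\sigma,\sigma'\in T$ there is an isometry (distance-preserving map) $f_{\sigma,\sigma'}:[0,d(\sigma,\sigma')]\to T$ with $f_{\sigma,\sigma'}(0)=\sigma$ and $f_{\sigma,\sigma'}(d(\sigma,\sigma'))=\sigma'$; write $[\![\sigma,\sigma']\!]=f_{\sigma,\sigma'}([0,d(\sigma,\sigma')])$; (2) if $q:[0,1]\to T$ is continuous and injective then $q([0,1])=[\![q(0),q(1)]\!]$. A rooted compact real tree $(T,d,\rho)$ is a compact real tree with a distinguished point $\rho\in T$. **Structured trees.** A structured compact real tree $(T,d,\rho,\leq,\mu)$ is a compact real tree $(T,d)$ with a root $\rho$, a linear order $\leq$ on $T$ and a finite Borel measure $\mu$ on $T$. Two such trees $(T,d,\rho,\leq,\mu)$ and $(T',d',\rho',\leq',\mu')$ are equivalent if there is an isometry $f$ from $(T,d)$ onto $(T',d')$ with $f(\rho)=\rho'$, with $f(\sigma_1)\leq' f(\sigma_2)$ whenever $\sigma_1\leq\sigma_2$, and with $\mu'=\mu\circ f^{-1}$. **Compatibility conditions.** - (Or1): for all $\sigma_1,\sigma_2\in T$, if $\sigma_1\in[\![\rho,\sigma_2]\!]$ then $\sigma_1\leq\sigma_2$. - (Or2): if $\sigma_1\leq\sigma_2\leq\sigma_3$, then $\gamma\in[\![\rho,\sigma_2]\!]$, where $\gamma$ is defined by $[\![\rho,\gamma]\!]=[\![\rho,\sigma_1]\!]\cap([\![\rho,\sigma_2]\!]\cup[\![\rho,\sigma_3]\!])$.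 - (Mes) for $\mu$: for all distinct $\sigma_1,\sigma_2\in T$ with $\sigma_1<\sigma_2$, $\mu(\{\sigma\in T:\sigma_1<\sigma<\sigma_2\})>0$. **Height functions.** For $M\geq 0$, $\mathcal{H}_M$ is the set of non-negative functions $h$ on $[0,M]$ that are left-continuous with right-limits and satisfy $h(0)=h(0+)=0$ and $h(t)-h(t+)\geq 0$ for $t\in[0,M)$ (conditions on right-limits are void if $M=0$). $\mathcal{H}=\bigcup_{M\ge 0}\mathcal{H}_M$, and $\zeta(h)=M$ for $h\in\mathcal{H}_M$. **Coding.** For $h\in\mathcal{H}_M$ and $s,t\in[0,M]$ set $d_h(s,t)=h(s)+h(t)-2\inf_{r\in[s\wedge t,s\vee t]}h(r)$ (a pseudo-distance). Let $s\sim_h t$ iff $d_h(s,t)=0$, $T_h=[0,M]/\sim_h$ with the induced distance $d_h$, and $p_h:[0,M]\to T_h$ the canonical projection. $(T_h,d_h)$ is a compact real tree. Set $\rho_h=p_h(0)$; $\sigma\leq_h\sigma'$ iff $\inf p_h^{-1}(\{\sigma\})\leq\inf p_h^{-1}(\{\sigma'\})$ (a linear order); $\mu_h(A)=\lambda(p_h^{-1}(A))$ for Borel $A\subset T_h$, with $\lambda$ Lebesgue measure. **(Min).** For $\sigma\in T_h$ let $\ell(\sigma)=\inf p_h^{-1}(\{\sigma\})$ and $r(\sigma)=\inf\{t>\ell(\sigma): p_h(t)\neq\sigma\}$ ($t$ ranging over $[0,\zeta(h)]$, with $\inf\emptyset=\zeta(h)$). Set $F(h)=\bigcup_{\sigma\in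 T_h}[\ell(\sigma),r(\sigma)]$ and $S(h)=[0,\zeta(h)]\setminus F(h)$. The function $h$ satisfies (Min) if $\lambda(S(h))=0$. **Known fact used to define $h,h'$.** For every structured compact real tree satisfying (Or1), (Or2) and (Mes) there is a unique $h\in\mathcal{H}$ satisfying (Min) whose coded structured tree is equivalent to it; in particular $\zeta(h)=\mu(T)$ and $\zeta(h')=\mu'(T)$. ''Time-change'' means a non-decreasing left-continuous $\varphi:[0,\mu(T)]\to[0,\infty)$ with $\varphi(0)=0$ and $h=h'\circ\varphi$; uniqueness in (i) is among such mappings. $\varphi(t+)$ is the right-limit. *)

(* Defs.v *)
From HB Require Import structures.
From mathcomp Require Import all_boot all_order all_algebra.
From mathcomp Require Import generic_quotient.
From mathcomp Require Import all_classical all_reals all_analysis.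
From mathcomp Require Import ring lra.
Set Implicit Arguments.
Unset Strict Implicit.
Unset Printing Implicit Defensive.
Import Order.TTheory GRing.Theory Num.Theory.
Import numFieldNormedType.Exports numFieldTopology.Exports.
Local Open Scope classical_set_scope.
Local Open Scope ring_scope.

(* A rooted metric space is a pointed one: its root is [point]. *)
#[short(type="rootedMetricType")]
HB.structure Definition RootedMetric (K : numDomainType) :=
  { T of Metric K T & Pointed T }.

Definition borel (R : realType) (T : rootedMetricType R) :=
  g_sigma_algebraType (@open T).

Section RealTrees.
Variables (R : realType) (T : rootedMetricType R).
Implicit Types (x y : T) (le : rel T).

Definition geodesic x y (f : R -> T) : Prop :=
  [/\ {in `[0, mdist x y] &, forall s t, mdist (f s) (f t) = `|s - t|},
      f 0 = x & f (mdist x y) = y].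

(* Image of a chosen geodesic; meaningful when there is a geodesic from [x] to
   [y], and independent of the choice in a real tree. *)
Definition segment x y : set T :=
  xget (fun=> x) [set f | geodesic x y f] @` `[0, mdist x y].

Definition real_tree : Prop :=
  (forall x y, exists f, geodesic x y f) /\
  (forall q : R -> T,
     {within `[0, 1], continuous q} -> {in `[0, 1] &, injective q} ->
     q @` `[0, 1] = segment (q 0) (q 1)).

Definition compact_real_tree : Prop := real_tree /\ compact [set: T].

Definition linear_order le : Prop :=
  [/\ reflexive le, antisymmetric le, transitive le & total le].

Definition Or1 le : Prop := forall x1 x2, segment point x2 x1 -> le x1 x2.

(* In a real tree there is exactly one [g] as below. *)
Definition Or2 le : Prop := forall x1 x2 x3 g, le x1 x2 -> le x2 x3 ->
  segment point g =
    segment point x1 `&` (segment point x2 `|` segment point x3) ->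
  segment point x2 g.

Definition strict le : rel T := fun x y => le x y && (x != y).

Definition Mes le (mu : set (borel T) -> \bar R) : Prop := forall x1 x2,
  strict le x1 x2 -> (0 < mu [set x | strict le x1 x && strict le x x2])%E.

End RealTrees.

(* Measures enter only through their values on Borel sets. *)
Definition structured_equiv (R : realType) (T T' : rootedMetricType R)
    (le : rel T) (mu : set (borel T) -> \bar R)
    (le' : rel T') (mu' : set (borel T') -> \bar R) : Prop :=
  exists f : T -> T',
    [/\ forall x y, mdist (f x) (f y) = mdist x y, range f = setT,
        f point = point, {homo f : x y / le x y >-> le' x y} &
        forall A : set (borel T'), measurable A -> mu' A = mu (f @^-1` A)].

Record is_height (R : realType) (M : R) (h : R -> R) : Prop := IsHeight {
  height_dom_ge0 : 0 <= M ;
  height_fun_ge0 : forall t, t \in `[0, M] -> 0 <= h t ;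
  height_left_cont : forall t, t \in `]0, M] -> h x @[x --> t^'-] --> h t ;
  height_right_lim : forall t, t \in `[0, M[ -> cvg (h x @[x --> t^'+]) ;
  height_at0 : h 0 = 0 ;
  height_right0 : 0 < M -> h x @[x --> 0^'+] --> 0 ;
  height_jump : forall t, t \in `[0, M[ -> lim (h x @[x --> t^'+]) <= h t }.

(* The values of [height_fun] outside [0, zeta] are junk and never used. *)
Record height (R : realType) := Height {
  zeta : R ;
  height_fun :> R -> R ;
  heightP : is_height zeta height_fun }.

Section Coding.
Variables (R : realType) (h : height R).

Definition hinf (s t : R) : R :=
  inf (h @` `[Num.min s t, Num.max s t]).

Definition hdist (s t : R) : R := h s + h t - 2 * hinf s t.

Definition hdom := {t : R | t \in `[0, zeta h]}.

Lemma hinf_le (s t r : R) : s \in `[0, zeta h] -> t \in `[0, zeta h] ->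
  Num.min s t <= r <= Num.max s t -> hinf s t <= h r.
Proof.
rewrite !in_itv /= => /andP[s0 sM] /andP[t0 tM] rst.
apply: ge_inf; last by exists r => //=; rewrite in_itv.
exists 0 => _ [u /= + <-]; rewrite in_itv /= => /andP[u1 u2].
apply: (height_fun_ge0 (heightP h)); rewrite in_itv /=; apply/andP; split.
  by apply: le_trans u1; rewrite le_min s0.
by apply: le_trans u2 _; rewrite ge_max sM.
Qed.

Lemma le_hinf (s t c : R) :
  (forall r, Num.min s t <= r <= Num.max s t -> c <= h r) -> c <= hinf s t.
Proof.
move=> hc; apply: lb_le_inf; last first.
  by move=> _ [u /= + <-]; rewrite in_itv /=; exact: hc.
exists (h s), s => //=.
by rewrite in_itv /= ge_min lexx /= le_max lexx.
Qed.

Lemma hdistxx s : s \in `[0, zeta h] -> hdist s s = 0.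
Proof.
move=> sM; rewrite /hdist; suff -> : hinf s s = h s by ring.
apply/eqP; rewrite eq_le hinf_le ?minxx ?maxxx ?lexx //=.
apply: le_hinf => r; rewrite minxx maxxx => /andP[r1 r2].
by have -> : r = s by apply/eqP; rewrite eq_le r1 r2.
Qed.

Lemma hdistC s t : hdist s t = hdist t s.
Proof. by rewrite /hdist /hinf minC maxC; ring. Qed.

Lemma hdist_triangle t s u :
    s \in `[0, zeta h] -> t \in `[0, zeta h] -> u \in `[0, zeta h] ->
  hdist s u <= hdist s t + hdist t u.
Proof.
move=> sM tM uM; rewrite /hdist.
have h1 : hinf s t <= h t by rewrite hinf_le // ge_min lexx orbT le_max lexx orbT.
have h2 : hinf t u <= h t by rewrite hinf_le // ge_min lexx le_max lexx.
suff : Num.min (hinf s t) (hinf t u) <= hinf s u.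
  by rewrite ge_min => /orP[] h3; lra.
apply: le_hinf => r rsu; rewrite ge_min; apply/orP.
have [rst|rst] := boolP (Num.min s t <= r <= Num.max s t).
  by left; exact: hinf_le.
right; apply: hinf_le => //; move: rsu rst.
by rewrite !ge_min !le_max; case: (leP s r); case: (leP t r);
  case: (leP u r); case: (leP r s); case: (leP r t); case: (leP r u) => //=; lra.
Qed.

Lemma hdist_ge0 s t : s \in `[0, zeta h] -> t \in `[0, zeta h] -> 0 <= hdist s t.
Proof.
by move=> sM tM; have := hdist_triangle sM tM sM;
   rewrite hdistxx // (hdistC t s); lra.
Qed.

Definition heq : rel hdom := fun s t => hdist (val s) (val t) == 0.

Lemma heq_equiv : equiv_class_of heq.
Proof.
split=> [s|s t|t s u]; rewrite /heq.
- by rewrite hdistxx // (valP s).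
- by rewrite hdistC.
move=> /eqP st /eqP tu; rewrite eq_le hdist_ge0 ?(valP s) ?(valP u) // andbT.
by have := hdist_triangle (valP s) (valP t) (valP u); rewrite st tu addr0.
Qed.

Canonical heq_rel := EquivRelPack heq_equiv.

Definition coded_tree := {eq_quot heq_rel}%qT.
HB.instance Definition _ := Choice.on coded_tree.

Definition code_proj (t : hdom) : coded_tree := (\pi_coded_tree t)%qT.

Definition cdist (x y : coded_tree) : R := hdist (val (repr x)) (val (repr y)).

Lemma cdist_proj s t : cdist (code_proj s) (code_proj t) = hdist (val s) (val t).
Proof.
have repr_proj (u : hdom) : hdist (val (repr (code_proj u))) (val u) = 0.
  by apply/eqP; have /eqmodP : repr (code_proj u) = u %[mod coded_tree]%qT
    by rewrite reprK.
rewrite /cdist; set a := repr _; set b := repr _.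
have sa : hdist (val a) (val s) = 0 by exact: repr_proj.
have tb : hdist (val b) (val t) = 0 by exact: repr_proj.
have [A B] := (valP a, valP b); have [S U] := (valP s, valP t).
have := hdist_triangle A S B; have := hdist_triangle S U B.
have := hdist_triangle S A U; have := hdist_triangle A B U.
by rewrite (hdistC (val s) (val a)) (hdistC (val t) (val b)) sa tb; lra.
Qed.

Lemma cdistxx x : cdist x x = 0.
Proof. by rewrite /cdist hdistxx // (valP (repr x)). Qed.

Lemma cdist_positivity x y : cdist x y = 0 -> x = y.
Proof.
move=> xy; rewrite -(reprK x) -(reprK y); apply/eqmodP.
by rewrite /= /heq; apply/eqP.
Qed.

Lemma cdistC x y : cdist x y = cdist y x.
Proof. exact: hdistC. Qed.

Lemma cdist_triangle y x z : cdist x z <= cdist x y + cdist y z.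
Proof. by apply: hdist_triangle; exact: valP. Qed.

HB.instance Definition _ := isMetric.Build R coded_tree
  cdistxx cdist_positivity cdistC cdist_triangle.

Lemma hdom0_subproof : 0 \in `[0, zeta h].
Proof. by rewrite in_itv /= lexx (height_dom_ge0 (heightP h)). Qed.

HB.instance Definition _ := isPointed.Build coded_tree
  (code_proj (exist _ 0 hdom0_subproof)).

(* Preimage under [code_proj], as a subset of the real line. *)
Definition code_preimage (A : set coded_tree) : set R :=
  val @` (code_proj @^-1` A).

Definition code_left (x : coded_tree) : R := inf (code_preimage [set x]).

Definition code_le : rel coded_tree := fun x y => code_left x <= code_left y.

Definition code_measure (A : set (borel coded_tree)) : \bar R :=
  lebesgue_measure (code_preimage A).

Definition code_right (x : coded_tree) : R :=
  let A := [set t | code_left x < t] `&` code_preimage (~` [set x]) in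
  if A == set0 then zeta h else inf A.

Definition Min : Prop :=
  lebesgue_measure
    (`[0, zeta h] `\`
     \bigcup_(x in [set: coded_tree]) `[code_left x, code_right x]%classic) = 0%E.

End Coding.

Definition codes (R : realType) (h : height R) (T : rootedMetricType R)
    (le : rel T) (mu : set (borel T) -> \bar R) : Prop :=
  Min h /\ structured_equiv (@code_le R h) (@code_measure R h) le mu.

Definition time_change (R : realType) (M : R) (h h' : height R)
    (phi : R -> R) : Prop :=
  [/\ {in `[0, M] &, {homo phi : s t / s <= t}},
      forall t, t \in `]0, M] -> phi x @[x --> t^'-] --> phi t,
      phi 0 = 0,
      forall t, t \in `[0, M] -> phi t \in `[0, zeta h'] &
      forall t, t \in `[0, M] -> h t = h' (phi t)].

(* Main.v *)
Require Import Defs.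
From mathcomp Require Import all_boot all_order all_algebra.
From mathcomp Require Import all_classical all_reals all_analysis.
From mathcomp Require Import generic_quotient ring lra.
Set Implicit Arguments.
Unset Strict Implicit.
Unset Printing Implicit Defensive.
Import Order.TTheory GRing.Theory Num.Theory.
Import numFieldNormedType.Exports.
Local Open Scope classical_set_scope.
Local Open Scope ring_scope.

(** Parametrize the tree by the two contours: [p t] is the point of [T] coded by
    the time [t] of [h], and [l x] is the first time at which [p] visits [x]; [p']
    and [l'] are the same for [h']. Heights are distances to the root, so [h] and
    [h'] are read off from [p] and [p'], and both orders of first visits are [le].
    Condition [Min] gives the gap property: if no point is visited for the first
    time during [(a, b)], then [p] stays at [p a] up to [b]
    (Lemma [coded_gap]). So a contour is determined by its first visits, and it
    can waste time only by pausing right after a first visit; these pauses are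
    exactly the atoms of the measure.

    Existence. Let [phi t] be the supremum of the [l' x] with [l x < t]. If some
    [x] is visited last among the points discovered before [t], then [p] pauses
    at [x] until [t] and [phi t = l' x]; otherwise the discovered points converge
    to [p t] along [p] and to [p' (phi t)] along [p']. Hence
    [p' (phi t) = p t] (Lemma [first_sup_visit]), and [h = h' o phi] follows.

    Rigidity. Conversely every time-change satisfies [p' o phi = p]
    (Lemma [tc_visit]), although [h = h' o phi] speaks of heights only. The
    infimum of [h] over [[s, t]] is at least the infimum of [h'] over
    [[phi s, phi t]], so the map [x |-> p' (phi (l x))] of [T] into itself does
    not decrease distances. It preserves heights, and it is increasing among the
    points of one height. If it moved [x], the orbit of [x] would be monotone
    for [le] inside one height, and then every later point of the orbit would be
    at least as far from [x] as the first one; expansion keeps all the points of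
    the orbit apart in the same way, which contradicts compactness.

    The assertions. Let [t] be a time, and suppose that [phi] jumps at [t], or
    that another time-change is larger than [phi] at [t]. In the window of times
    of [h'] thus skipped, [p'] discovers no new point [y]: such a [y] would have
    [l y > t], while [p'] would run through [p s] for times [s < l y] between two
    visits of [y], making [p s] a descendant of [y] visited by [p] before [y]. By
    the gap property [p'] pauses at [p t] in the window. So [h'] is constant in a
    jump of [phi], there is no jump if [mu'] has no atom, and a discrepancy of two
    time-changes yields a pause of both contours, i.e. a common atom. If [phi] is
    not strictly increasing then [p = p' o phi] pauses, so [mu] has an atom. Finally, at a common atom one may enter the pause of [p'] at
    its first time or at a later one, which gives two time-changes. *)

(** * One-sided limits and heights *)

Lemma cvg_at_leftE (R : realType) (f : R -> R) (t l : R) :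
  f x @[x --> t^'-] --> l <->
  forall e, 0 < e -> exists2 a, a < t & forall s, a < s < t -> `|l - f s| < e.
Proof.
split=> [/cvgrPdist_lt fl e e0|H].
  have [d /= d0 Hd] := fl e e0.
  exists (t - d) => [|s /andP[s1 s2]]; first by lra.
  by apply: Hd => //=; rewrite ltr_distl; lra.
apply/cvgrPdist_lt => e e0; have [a lt_at Ha] := H e e0.
near=> s; apply: Ha; apply/andP; split; near: s.
  exact: nbhs_left_gt.
exact: nbhs_left_lt.
Unshelve. all: by end_near.
Qed.

Lemma cvg_at_rightE (R : realType) (f : R -> R) (t l : R) :
  f x @[x --> t^'+] --> l <->
  forall e, 0 < e -> exists2 b, t < b & forall s, t < s < b -> `|l - f s| < e.
Proof.
split=> [/cvgrPdist_lt fl e e0|H].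
  have [d /= d0 Hd] := fl e e0.
  exists (t + d) => [|s /andP[s1 s2]]; first by lra.
  by apply: Hd => //=; rewrite ltr_distl; lra.
apply/cvgrPdist_lt => e e0; have [b lt_tb Hb] := H e e0.
near=> s; apply: Hb; apply/andP; split; near: s.
  exact: nbhs_right_gt.
exact: nbhs_right_lt.
Unshelve. all: by end_near.
Qed.

Section Heights.
Variables (R : realType) (h : height R).
Local Notation M := (zeta h).
Implicit Types (s t c : R).

Lemma height_left_eps t e : 0 < t <= M -> 0 < e ->
  exists2 a, 0 <= a < t & forall s, a < s < t -> `|h t - h s| < e.
Proof.
move=> /andP[t0 tM] e0.
have /cvg_at_leftE/(_ e e0)[a lt_at ha] :=
  height_left_cont (heightP h) (t := t) ltac:(by rewrite in_itv /= t0).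
exists (Num.max a 0); first by rewrite le_max lexx orbT gt_max lt_at.
by move=> s; rewrite gt_max => /andP[/andP[a_s _] st]; apply: ha; rewrite a_s.
Qed.

(** A height has no upward jump, so it cannot be below a bound that holds just after. *)
Lemma height_right_ge t b c : 0 <= t -> t < b <= M ->
  (forall s, t < s <= b -> c <= h s) -> c <= h t.
Proof.
move=> t0 /andP[tb bM] hc.
have tM : t \in `[0, M[ by rewrite in_itv /= t0 (lt_le_trans tb).
apply: le_trans (height_jump (heightP h) tM).
have /cvg_at_rightE hl := height_right_lim (heightP h) tM.
rewrite leNgt; apply/negP => lc.
have [d td hd] := hl _ (ltac:(by rewrite subr_gt0) : 0 < c - lim (h x @[x --> t^'+])).
pose s := (t + Num.min b d) / 2.
have [ts sb sd] : [/\ t < s, s < b & s < d].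
  by rewrite /s; case: (leP b d) => bd; split; lra.
have := hc s; rewrite ts (ltW sb) => /(_ isT) cs.
have := hd s; rewrite ts sd => /(_ isT); rewrite ltr_distl; lra.
Qed.

(** A height only jumps downwards, so an intermediate value [c] is attained on the
    way up to [h t]; the last such time codes the ancestor of height [c]. *)
Lemma ancestor_time t c : 0 <= t <= M -> 0 <= c <= h t ->
  exists s, [/\ 0 <= s <= t, h s = c & forall v, s <= v <= t -> c <= h v].
Proof.
move=> /andP[t0 tM] /andP[c0 ct].
(* The last time before [t] at which [h] is at most [c]. *)
pose A := [set s | 0 <= s <= t /\ h s <= c].
have A0 : A 0 by split; rewrite ?lexx ?t0 // (height_at0 (heightP h)).
have supA : has_sup A by split; [exists 0 | exists t => s [/andP[]]].
pose s := sup A.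
have s0 : 0 <= s by apply: ub_le_sup => //; case: supA.
have st : s <= t by apply: ge_sup; [exists 0 | move=> u [/andP[]]].
have above v : s < v <= t -> c <= h v.
  move=> /andP[sv vt]; rewrite leNgt; apply/negP => vc.
  suff : v <= s by rewrite leNgt sv.
  by apply: ub_le_sup; [case: supA | split; rewrite ?vt ?(le_trans s0) ?ltW].
have hs_le : h s <= c.
  have [/eqP s_eq0|s_neq0] := boolP (s == 0).
    by rewrite s_eq0 (height_at0 (heightP h)).
  rewrite leNgt; apply/negP => cs.
  have [a /andP[a0 a_s] ha] := @height_left_eps s (h s - c)
    ltac:(by rewrite lt_neqAle eq_sym s_neq0 s0 (le_trans st)) ltac:(by rewrite subr_gt0).
  have [u Au au] : exists2 u, A u & a < u.
    by have [u Au] := sup_adherent (ltac:(by rewrite subr_gt0) : 0 < s - a) supA;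
      rewrite opprB addrCA subrr addr0 => au; exists u.
  have us : u <= s by apply: ub_le_sup => //; case: supA.
  case: Au => _ uc; move: us; rewrite le_eqVlt => /orP[/eqP us|us].
    by move: uc; rewrite us leNgt cs.
  have := ha u; rewrite au us => /(_ isT); rewrite ltr_distl; lra.
have c_le : c <= h s.
  move: st; rewrite le_eqVlt => /orP[/eqP->//|st].
  by apply: (@height_right_ge s t) => //; rewrite st.
have hs : h s = c by apply/eqP; rewrite eq_le hs_le.
exists s; split; rewrite ?s0 // => v /andP[]; rewrite le_eqVlt => /orP[/eqP<-|sv] vt.
  by rewrite hs.
by apply: above; rewrite sv.
Qed.

End Heights.

(** * Contours of a rooted tree *)

Section Contour.
Variables (R : realType) (T : rootedMetricType R) (h : height R).
Local Notation M := (zeta h).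

(** In a real tree this says that [x] lies on the segment from the root to [y]. *)
Definition ancestor (x y : T) : Prop :=
  mdist point y = mdist point x + mdist x y.

(** The metric part of a coding: [p] explores [T] and [l] records first visits. It is
    stated on an arbitrary rooted metric space so as to apply to the coded tree
    itself as well as to any tree equivalent to it. *)
Record contour (p : R -> T) (l : T -> R) : Prop := Contour {
  contour_dist : forall s t, 0 <= s <= M -> 0 <= t <= M ->
    mdist (p s) (p t) = hdist h s t ;
  contour_root : p 0 = point ;
  first_dom : forall x, 0 <= l x <= M ;
  first_visit : forall x, p (l x) = x ;
  first_le : forall t, 0 <= t <= M -> l (p t) <= t }.

Lemma hinf_lower (s t v : R) : 0 <= s <= M -> 0 <= t <= M ->
  Num.min s t <= v <= Num.max s t -> hinf h s t <= h v.
Proof. by move=> s0 t0 v0; apply: hinf_le; rewrite ?in_itv. Qed.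

Lemma hinf_base (s t : R) : 0 <= s <= M -> 0 <= t <= M ->
  (forall v, Num.min s t <= v <= Num.max s t -> h s <= h v) -> hinf h s t = h s.
Proof.
move=> s0 t0 hv; apply/eqP; rewrite eq_le le_hinf // andbT.
by apply: hinf_lower => //; rewrite ge_min lexx /= le_max lexx.
Qed.

Variables (p : R -> T) (l : T -> R).
Hypothesis C : contour p l.
Implicit Types (s t v : R) (x y z : T).

Lemma dom0 : 0 <= (0 : R) <= M.
Proof. by rewrite lexx (height_dom_ge0 (heightP h)). Qed.

Lemma height_ge0 t : 0 <= t <= M -> 0 <= h t.
Proof. by move=> t0; apply: (height_fun_ge0 (heightP h)); rewrite in_itv. Qed.

Lemma dist_root t : 0 <= t <= M -> mdist point (p t) = h t.
Proof.
move=> t0; rewrite -(contour_root C) (contour_dist C dom0 t0) /hdist.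
have h0 := height_at0 (heightP h).
rewrite hinf_base ?dom0 // h0; first by ring.
move=> v /andP[v1 v2]; apply: height_ge0; move: v1 v2 t0.
by case: (leP 0 t) => //=; lra.
Qed.

Lemma height_first x : h (l x) = mdist point x.
Proof. by rewrite -dist_root ?(first_dom C) // (first_visit C). Qed.

Lemma ancestor_above s t : 0 <= s <= M -> 0 <= t <= M ->
  (forall v, Num.min s t <= v <= Num.max s t -> h s <= h v) ->
  ancestor (p s) (p t).
Proof.
move=> s0 t0 hv; rewrite /ancestor !dist_root // (contour_dist C s0 t0) /hdist.
by rewrite hinf_base //; ring.
Qed.

Lemma above_ancestor s t v : 0 <= s <= M -> 0 <= t <= M ->
  ancestor (p s) (p t) -> Num.min s t <= v <= Num.max s t -> h s <= h v.
Proof.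
move=> s0 t0; rewrite /ancestor !dist_root // (contour_dist C s0 t0) /hdist => a v0.
have := hinf_lower s0 t0 v0; lra.
Qed.

Lemma between_visits s t v : 0 <= s -> s <= v <= t -> t <= M -> p s = p t ->
  ancestor (p s) (p v).
Proof.
move=> s0 /andP[sv vt] tM pst.
have [ds dv dt] : [/\ 0 <= s <= M, 0 <= v <= M & 0 <= t <= M] by split; lra.
apply: ancestor_above => // u /andP[u1 u2].
apply: (@above_ancestor s t) => //.
  by rewrite /ancestor pst mdistxx addr0.
have st := le_trans sv vt; move: u1 u2; rewrite !min_l ?max_r //; lra.
Qed.

(** The contour reaches [y] from the root without upward jumps, so it has met each
    ancestor of [y] by then; that this last meeting is a visit of [x] itself comes
    from the fact that [h] stays above the height of [x] between it and [l x]. *)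
Lemma ancestor_first x y : ancestor x y -> l x <= l y.
Proof.
move=> axy; have [dx dy] := (first_dom C x, first_dom C y).
have Hxy : 0 <= h (l x) <= h (l y).
  rewrite !height_first axy.
  by have := mdist_ge0 (point : T) x; have := mdist_ge0 x y; lra.
have [s [/andP[s0 sy] hs habove]] := ancestor_time dy Hxy.
have ds : 0 <= s <= M by lra.
suff ps : p s = x by rewrite -ps; apply: le_trans sy; exact: (first_le C).
apply: mdist_positivity; rewrite -[in mdist _ x](first_visit C x) (contour_dist C ds dx).
rewrite /hdist hinf_base ?hs; [by ring| by [] | by [] |].
move=> v; have [sx|xs] := leP s (l x) => /andP[v1 v2].
  have [vy|yv] := leP v (l y); first by apply: habove; rewrite v1.
  apply: (@above_ancestor (l x) (l y)) => //; rewrite ?(first_visit C) //.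
  by rewrite ge_min le_max (ltW yv) v2 orbT.
apply: (@above_ancestor (l x) (l y)) => //; rewrite ?(first_visit C) //.
by rewrite ge_min le_max v1 (le_trans v2 sy) orbT.
Qed.

Lemma contour_left_cont t e : 0 < t <= M -> 0 < e ->
  exists2 a, 0 <= a < t & forall s, a < s <= t -> mdist (p s) (p t) < e.
Proof.
move=> /andP[t0 tM] e0.
have [a /andP[a0 lt_at] ha] := @height_left_eps R h t (e / 3) ltac:(by rewrite t0) ltac:(lra).
exists a; first by rewrite a0.
move=> s /andP[a_s]; rewrite le_eqVlt => /orP[/eqP->|st]; first by rewrite mdistxx.
have [ds dt] : 0 <= s <= M /\ 0 <= t <= M by lra.
rewrite (contour_dist C ds dt) /hdist.
have : h t - e / 3 <= hinf h s t.
  apply: le_hinf => v; rewrite (min_l (ltW st)) (max_r (ltW st)) => /andP[sv].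
  rewrite le_eqVlt => /orP[/eqP->|vt]; first by lra.
  by have := ha v; rewrite (lt_le_trans a_s) // vt => /(_ isT); rewrite ltr_distl; lra.
by have := ha s; rewrite a_s st => /(_ isT); rewrite ltr_distl; lra.
Qed.

(** A contour inherits left-continuity from its height, so a pause includes its
    right endpoint. *)
Lemma constant_closed a t x : 0 <= a < t -> t <= M ->
  (forall s, a < s < t -> p s = x) -> p t = x.
Proof.
move=> /andP[a0 lt_at] tM px; apply/eqP; rewrite eq_sym; apply/negPn; apply/negP.
rewrite -mdist_gt0 => d0.
have [b /andP[b0 bt] hb] := @contour_left_cont t _ ltac:(lra) d0.
pose s := (Num.max a b + t) / 2.
have [a_s bs st] : [/\ a < s, b < s & s < t].
  by rewrite /s; case: (leP a b) => ab; split; lra.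
by have := hb s; rewrite bs (ltW st) px ?a_s // ltxx => /(_ isT).
Qed.

End Contour.

(** * The contour of the coded tree *)

Section CodedTree.
Variables (R : realType) (h : height R).
Local Notation M := (zeta h).
Implicit Types (s t : R) (x y : coded_tree h).

(** The projection of the coding, extended to all reals by the value at time 0. *)
Definition visit t : coded_tree h :=
  code_proj (insubd (exist _ 0 (hdom0_subproof h) : hdom h) t).

Lemma visit_dist s t : 0 <= s <= M -> 0 <= t <= M ->
  mdist (visit s) (visit t) = hdist h s t.
Proof.
move=> s0 t0; rewrite [LHS]cdist_proj.
by rewrite !insubdK // /in_mem /= in_itv.
Qed.

Lemma visit_onto x : exists2 t, 0 <= t <= M & visit t = x.
Proof.
exists (val (repr x)).
  by have := valP (repr x); rewrite in_itv.
by rewrite /visit valKd -[RHS]reprK.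
Qed.

Lemma code_preimageE (A : set (coded_tree h)) :
  code_preimage A = [set t | 0 <= t <= M /\ A (visit t)].
Proof.
apply/seteqP; split=> [_ [u /= Au <-]|t [t0 At]].
  have := valP u; rewrite in_itv /= => ->; split => //.
  by rewrite /visit valKd.
exists (insubd (exist _ 0 (hdom0_subproof h) : hdom h) t) => //=.
by rewrite insubdK // /in_mem /= in_itv.
Qed.

Lemma code_left_inf x : has_inf (code_preimage [set x]).
Proof.
rewrite code_preimageE; split; last by exists 0 => t [/andP[]].
by have [t t0 tx] := visit_onto x; exists t.
Qed.

Lemma code_left_le t : 0 <= t <= M -> code_left (visit t) <= t.
Proof.
move=> t0; apply: ge_inf; first by case: (code_left_inf (visit t)).
by rewrite code_preimageE.
Qed.

Lemma code_left_dom x : 0 <= code_left x <= M.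
Proof.
have [t t0 tx] := visit_onto x; apply/andP; split.
  apply: lb_le_inf; first by case: (code_left_inf x).
  by rewrite code_preimageE => u [/andP[]].
by rewrite -tx; apply: le_trans (code_left_le t0) _; case/andP: t0.
Qed.

(** The infimum [a] of the visit times is a visit. Between [a] and a visit [t] the height
    is at least [h t], because there are visits arbitrarily close to [a] on its
    right; hence [h a >= h t], and the ancestor of height [h t] met by time [a] is [x]
    again, at a time which cannot be smaller than [a]. *)
Lemma visit_code_left x : visit (code_left x) = x.
Proof.
have [t t0 tx] := visit_onto x; set a := code_left x.
have at_ : a <= t by rewrite /a -tx; exact: code_left_le.
have da : 0 <= a <= M := code_left_dom x.
have above v : a < v <= t -> h t <= h v.
  move=> /andP[av vt].
  have [u] := inf_adherent (ltac:(by rewrite subr_gt0) : 0 < v - a) (code_left_inf x).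
  rewrite addrCA subrr addr0 code_preimageE => -[u0 ux] uv.
  have ht : hdist h u t = 0 by rewrite -visit_dist // ux tx mdistxx.
  have := @hinf_lower R h u t v u0 t0.
  have := @hinf_lower R h u t u u0 t0.
  have ut : u <= t := le_trans (ltW uv) vt.
  rewrite (min_l ut) (max_r ut) lexx ut (ltW uv) vt => /(_ isT) + /(_ isT).
  by move: ht; rewrite /hdist; lra.
have c_le : h t <= h a.
  move: at_; rewrite le_eqVlt => /orP[/eqP->//|a_t].
  by apply: (@height_right_ge R h a t) above; lra.
have [|s [/andP[s0 sa] hs habove]] := @ancestor_time R h a (h t) da.
  by rewrite height_ge0.
have ds : 0 <= s <= M by lra.
have vs : visit s = x.
  rewrite -tx; apply: mdist_positivity; rewrite visit_dist // /hdist hinf_base // hs; first by ring.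
  have st := le_trans sa at_; move=> v; rewrite (min_l st) (max_r st) => /andP[sv vt].
  by have [va|av] := leP v a; [apply: habove; rewrite sv|apply: above; rewrite av].
suff -> : a = s by [].
by apply/eqP; rewrite eq_le sa andbT /a -vs; exact: code_left_le.
Qed.

Lemma contour_coded : contour h visit (@code_left R h).
Proof.
split; [exact: visit_dist| |exact: code_left_dom|exact: visit_code_left|
  exact: code_left_le].
by congr code_proj; apply: val_inj; rewrite insubdK // hdom0_subproof.
Qed.

Lemma visit_until_right x t : code_left x <= t <= code_right x ->
  visit t = x /\ t <= M.
Proof.
have [l0 lM] := andP (code_left_dom x).
have before u : code_left x <= u < code_right x -> visit u = x /\ u <= M.
  move=> /andP[]; rewrite le_eqVlt => /orP[/eqP<-|lu] ur.
    by rewrite visit_code_left.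
  have uM : u <= M.
    rewrite leNgt; apply/negP => Mu; move: ur; rewrite /code_right.
    case: ifPn => [_|/set0P[v Av]]; first by rewrite ltNge ltW.
    rewrite code_preimageE in Av *; rewrite ltNge => /negP; apply.
    apply: le_trans (ltW Mu); apply: le_trans (ge_inf _ Av) _; last by case: Av => _ [/andP[]].
    by exists 0 => w [_ [/andP[]]].
  split=> //; apply: contrapT => ux; move: ur; rewrite /code_right.
  rewrite code_preimageE.
  have Au : ([set t | code_left x < t] `&`
      [set t | 0 <= t <= M /\ (~` [set x]) (visit t)]) u.
    by split=> //=; split=> //; lra.
  case: ifPn => [/eqP A0|_]; first by rewrite A0 in Au.
  rewrite ltNge => /negP; apply; apply: ge_inf => //.
  by exists 0 => w [_ [/andP[]]].
move=> /andP[lt tr]; have [tr'|rt] := ltP t (code_right x); first by apply: before; rewrite lt.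
have {tr rt} tr : t = code_right x by apply/eqP; rewrite eq_le tr.
move: lt; rewrite le_eqVlt => /orP[/eqP<-|lt]; first by rewrite visit_code_left.
have tM : t <= M.
  rewrite leNgt; apply/negP => Mt.
  by have [|_] := before ((Num.max (code_left x) M + t) / 2); rewrite -?tr;
    case: (leP (code_left x) M); lra.
split=> //; apply: (constant_closed contour_coded (a := code_left x)); rewrite ?l0 //.
by move=> s /andP[ls st]; case: (before s); rewrite // -tr st ltW.
Qed.

End CodedTree.

(** * Pauses, first visits and atoms *)

Section LebesgueOfCode.
Variables (R : realType) (h : height R).
Local Notation M := (zeta h).
Implicit Types (a b t u : R) (x y : coded_tree h).

Lemma not_null_of_itv (A : set R) a b : a < b ->
  (forall u, a < u < b -> A u) -> lebesgue_measure A <> 0%E.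
Proof.
move=> ab sub A0.
have : (lebesgue_measure (`]a, b[%classic : set R) <= lebesgue_measure A)%E.
  by apply: le_outer_measure => u /=; rewrite in_itv; exact: sub.
rewrite A0 lebesgue_measure_itv /= lte_fin ab.
by rewrite -EFinB lee_fin; lra.
Qed.

Lemma Min_dense a b : Min h -> 0 <= a < b -> b <= M ->
  exists x u, a < u < b /\ code_left x <= u <= code_right x.
Proof.
move=> hm /andP[a0 ab] bM; apply: contrapT => none.
apply: (not_null_of_itv ab _ hm) => u /andP[au ub]; split=> /=.
  by rewrite in_itv /=; lra.
move=> [x _ /=]; rewrite in_itv /= => xu; apply: none; exists x, u.
by rewrite au.
Qed.

(** Condition [Min] puts in every subinterval of [(a, b)] a time at which the contour
    has been pausing since a first visit. That first visit took place by time [a], so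
    the pause is at [visit h a] and extends as close to [b] as desired. *)
Lemma coded_gap a b : Min h -> 0 <= a < b -> b <= M ->
  (forall x, ~ a < code_left x < b) ->
  forall u, code_left (visit h a) <= u <= b -> visit h u = visit h a.
Proof.
move=> hm /andP[a0 ab] bM gap.
have before c : c < b -> forall u, code_left (visit h a) <= u <= c ->
    visit h u = visit h a.
  move=> cb u /andP[lu uc].
  have [||x [v [/andP[cv vb] /andP[xv vx]]]] := @Min_dense (Num.max a c) b hm; rewrite ?bM //.
    by rewrite le_max a0 gt_max ab.
  move: cv; rewrite gt_max => /andP[av cv].
  have xa : code_left x <= a.
    by rewrite leNgt; apply/negP => ax; apply: (gap x); rewrite ax; lra.
  have same w : code_left x <= w <= v -> visit h w = x.
    move=> /andP[xw wv]; apply: (visit_until_right _).1.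
    by rewrite xw (le_trans wv).
  have ax : visit h a = x by apply: same; rewrite xa ltW.
  by rewrite ax; apply: same; rewrite -ax lu; lra.
move=> u /andP[lu]; rewrite le_eqVlt => /orP[/eqP->|ub]; last first.
  by apply: (before u) => //; rewrite lu lexx.
apply: (constant_closed (contour_coded h) (a := a)); rewrite ?a0 //.
move=> s /andP[a_s sb]; apply: (before s) => //.
by rewrite lexx andbT ltW // (le_lt_trans _ a_s) // code_left_le //; lra.
Qed.

(** Up to a null set, the times spent at [x] are those of its initial pause. *)
Lemma coded_atom_itv x : Min h ->
  lebesgue_measure (code_preimage [set x]) <> 0%E ->
  exists b, code_left x < b <= M /\
    forall u, code_left x <= u <= b -> visit h u = x.
Proof.
move=> hm x_gt0; apply: contrapT => none; apply: x_gt0.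
apply/eqP; rewrite eq_le outer_measure_ge0 andbT.
have := hm; rewrite /Min; set N := (X in lebesgue_measure X) => N0.
have : (lebesgue_measure (code_preimage [set x]) <=
    lebesgue_measure (N `|` [set code_left x]))%E.
  apply: le_outer_measure => t; rewrite code_preimageE => -[t0 tx].
  have [->|lt] := eqVneq t (code_left x); first by right.
  left; split=> [/=|[y _ /=]]; rewrite in_itv //= => yt.
  have [yx tM] := visit_until_right yt; apply: none.
  have exy : x = y by rewrite -yx -tx.
  case/andP: yt => yt ty; exists t.
  rewrite lt_neqAle eq_sym lt exy yt tM; split=> // u /andP[yu ut].
  by apply: (visit_until_right _).1; rewrite yu (le_trans ut).
move/le_trans; apply.
have : (lebesgue_measure (N `|` [set code_left x]) <=
    lebesgue_measure N + lebesgue_measure [set code_left x])%E.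
  exact: outer_measureU2.
by rewrite N0 lebesgue_measure_set1 adde0.
Qed.

Lemma coded_mass : code_measure [set: borel (coded_tree h)] = M%:E.
Proof.
have -> : code_measure [set: borel (coded_tree h)] =
    lebesgue_measure (`[0, M]%classic : set R).
  rewrite /code_measure code_preimageE; congr (lebesgue_measure _).
  by apply/seteqP; split=> t /=; rewrite in_itv /= => // -[].
rewrite lebesgue_measure_itv /= lte_fin oppr0 adde0.
by have := height_dom_ge0 (heightP h); rewrite le_eqVlt => /orP[/eqP<-|->]; rewrite ?ltxx.
Qed.

End LebesgueOfCode.

(** * Codings of a structured tree *)

Section Coding.
Variables (R : realType) (T : rootedMetricType R) (h : height R).
Variables (le : rel T) (mu : set (borel T) -> \bar R).
Local Notation M := (zeta h).

(** All that is used of a coding of [(T, le, mu)] by [h]: the contour, the agreement of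
    the order with first visits, the gap property, the correspondence between
    atoms and pauses, and the total mass. *)
Record coding (p : R -> T) (l : T -> R) : Prop := Coding {
  coding_contour :> contour h p l ;
  coding_le : forall x y, le x y = (l x <= l y) ;
  coding_gap : forall a b, 0 <= a < b -> b <= M ->
    (forall x, ~ a < l x < b) -> forall u, l (p a) <= u <= b -> p u = p a ;
  coding_atom : forall x a b, 0 <= a < b -> b <= M ->
    (forall u, a <= u <= b -> p u = x) -> mu [set x] <> 0%E ;
  coding_atom_itv : forall x, mu [set x] <> 0%E ->
    exists b, l x < b <= M /\ forall u, l x <= u <= b -> p u = x ;
  coding_mass : mu setT = M%:E }.

Lemma measurable_point (x : T) : measurable ([set x] : set (borel T)).
Proof.
rewrite -[X in measurable X]setCK; apply: measurableC.
apply: sub_sigma_algebra; apply: closed_openC.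
exact/accessible_closed_set1/hausdorff_accessible/metric_hausdorff.
Qed.

Lemma codes_coding : linear_order le -> codes h le mu ->
  exists p l, coding p l.
Proof.
move=> [_ le_anti _ _] [hm [f [f_dist f_onto f_root f_le f_mu]]].
have /choice[g gK] : forall y, exists x, f x = y.
  move=> y; have [x _ <-] : range f y by rewrite f_onto.
  by exists x.
have f_inj x y : f x = f y -> x = y.
  by move=> fxy; apply: mdist_positivity; rewrite -f_dist fxy mdistxx.
have fK x : g (f x) = x by apply: f_inj; rewrite gK.
have mu1 y : mu [set y] = lebesgue_measure (code_preimage [set g y]).
  rewrite f_mu; last exact: measurable_point.
  rewrite /code_measure; congr (lebesgue_measure (code_preimage _)).
  by apply/seteqP; split=> x /= => [<-|->]; rewrite ?fK ?gK.
have C := contour_coded h.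
exists (f \o visit h), (@code_left R h \o g); split.
- split => [s t s0 t0|||x|t t0] /=.
  + by rewrite f_dist visit_dist.
  + by rewrite -f_root (contour_root C).
  + by move=> x; exact: code_left_dom.
  + by rewrite visit_code_left gK.
  + by rewrite fK code_left_le.
- move=> x y /=; apply/idP/idP => [lexy|].
    rewrite leNgt; apply/negP => gyx.
    have leyx : le y x by rewrite -(gK x) -(gK y); apply: f_le; exact: ltW.
    have exy : x = y by apply: le_anti; rewrite lexy.
    by rewrite exy ltxx in gyx.
  by move=> gxy; rewrite -(gK x) -(gK y); exact: f_le.
- move=> a b a0 bM gap u /=; rewrite fK => ub.
  congr f; apply: coded_gap ub => // x xb; apply: (gap (f x)).
  by rewrite /= fK.
- move=> x a b /andP[a0 ab] bM px; rewrite mu1; apply: (not_null_of_itv ab) => u /andP[au ub].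
  rewrite code_preimageE; split; first by lra.
  by apply: f_inj; rewrite gK -[RHS](px u) // !ltW.
- move=> x; rewrite mu1 => /(coded_atom_itv hm)[b [lb pb]]; exists b; split=> // u ub.
  by rewrite /= pb ?gK.
rewrite f_mu; last exact: measurableT.
by rewrite preimage_setT coded_mass.
Qed.

End Coding.

(** * Recurrence in a compact space *)

Lemma compact_recurrence (R : realType) (T : rootedMetricType R) (u : nat -> T)
    (e : R) : compact [set: T] -> 0 < e ->
  exists n m, (n < m)%N /\ mdist (u n) (u m) < e.
Proof.
move=> cT e0; have [q [_ cl]] := cT (u @ \oo) _ filterT.
have nq : nbhs q (ball q (e / 2)) by apply: nbhsx_ballx; lra.
have ur : \forall k \near \oo, range u (u k) by apply: nearW => k; exists k.
have [_ [[n _ <-]]] := cl _ _ ur nq.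
rewrite ballEmdist /= => nun.
have um : \forall k \near \oo, [set u m | m in [set m | (n < m)%N]] (u k).
  by exists n.+1 => // k /= nk; exists k.
have [_ [[m /= nm <-]]] := cl _ _ um nq.
rewrite ballEmdist /= => num; exists n, m; split => //.
by have := metric_triangle (u n) q (u m); rewrite (metric_sym (u n) q); lra.
Qed.

(** * Rigidity of time-changes *)

Section TimeChange.
Variables (R : realType) (T : rootedMetricType R) (le : rel T).
Variables (mu mu' : set (borel T) -> \bar R) (h h' : height R).
Variables (p p' : R -> T) (l l' : T -> R).
Hypothesis C : coding h le mu p l.
Hypothesis C' : coding h' le mu' p' l'.
Local Notation M := (zeta h).
Local Notation M' := (zeta h').
Implicit Types (s t u v w : R) (x y z : T) (phi psi : R -> R).

Lemma same_first_lt x y : (l x < l y) = (l' x < l' y).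
Proof. by rewrite !ltNge -(coding_le C) -(coding_le C'). Qed.

(** Between two points of equal height, the distance is governed by the minimum of
    [h] between their visits, which can only decrease when the second visit moves
    away from the first. *)
Lemma first_closer x y z : mdist point x = mdist point y ->
  mdist point y = mdist point z -> l x <= l y <= l z \/ l z <= l y <= l x ->
  mdist x y <= mdist x z.
Proof.
move=> xy yz lxyz.
have [[dx dy] dz] := (first_dom C x, first_dom C y, first_dom C z).
rewrite -(first_visit C x) -(first_visit C y) -(first_visit C z).
rewrite !(contour_dist C) // /hdist !(height_first C) xy yz.
suff : hinf h (l x) (l z) <= hinf h (l x) (l y) by lra.
apply: le_hinf => v v0; apply: hinf_lower => //; move: v0 lxyz.
by case: (leP (l x) (l y)); case: (leP (l x) (l z)); lra.
Qed.

(** When [v] lies between two visits of [y], the point [p' v] descends from [y],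
    and an ancestor is visited first by both contours. *)
Lemma first_le_between y v v' : l' y <= v <= v' -> v' <= M' -> p' v' = y ->
  l y <= l (p' v).
Proof.
move=> vv vM pv; have /andP[ly0 _] := first_dom C' y.
apply: (ancestor_first C); rewrite -[y in ancestor y _](first_visit C').
by apply: (between_visits C' ly0 vv vM); rewrite (first_visit C').
Qed.

Section Visits.
Variable phi : R -> R.
Hypothesis tc : time_change M h h' phi.

Lemma tc_mono s t : 0 <= s -> s <= t <= M -> phi s <= phi t.
Proof.
case: tc => mono _ _ _ _ s0 /andP[st tM].
by apply: mono; rewrite ?in_itv /=; lra.
Qed.

Lemma tc_dom t : 0 <= t <= M -> 0 <= phi t <= M'.
Proof.
by case: tc => _ _ _ dom _ t0; have := dom t; rewrite !in_itv /= => /(_ t0).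
Qed.

Lemma tc_height t : 0 <= t <= M -> h' (phi t) = h t.
Proof.
by case: tc => _ _ _ _ eqh t0; have := eqh t; rewrite !in_itv /= => /(_ t0).
Qed.

(** Along [phi], the contour [p'] sees all the values of [h] between [s] and [t], and
    possibly lower ones inside the jumps of [phi]. *)
Lemma tc_expanding s t : 0 <= s <= M -> 0 <= t <= M ->
  mdist (p s) (p t) <= mdist (p' (phi s)) (p' (phi t)).
Proof.
move=> ds dt; have [ds' dt'] := (tc_dom ds, tc_dom dt).
rewrite (contour_dist C ds dt) (contour_dist C' ds' dt') /hdist !tc_height //.
suff : hinf h' (phi s) (phi t) <= hinf h s t by lra.
wlog st : s t ds dt ds' dt' / s <= t => [wl|].
  have [/wl|/ltW/wl] := leP s t; first exact.
  by rewrite /hinf (minC t) (maxC t) (minC (phi t)) (maxC (phi t)); exact.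
apply: le_hinf => v; rewrite (min_l st) (max_r st) => /andP[sv vt].
have [dv] : 0 <= v <= M by lra.
rewrite -tc_height //; apply: hinf_lower => //.
have [sv' vt'] : phi s <= phi v /\ phi v <= phi t.
  by split; apply: tc_mono; lra.
by rewrite ge_min sv' le_max vt' orbT.
Qed.

Let shift x := p' (phi (l x)).

Lemma shift_height x : mdist point (shift x) = mdist point x.
Proof.
have dx := first_dom C x.
by rewrite (dist_root C') ?tc_dom // tc_height // (height_first C).
Qed.

Lemma shift_expanding x y : mdist x y <= mdist (shift x) (shift y).
Proof.
rewrite -{1}(first_visit C x) -{1}(first_visit C y).
by apply: tc_expanding; exact: first_dom C _.
Qed.

(** Otherwise the times [l' (shift y) <= phi (l x) <= phi (l y)] would place
    [shift x] between two visits of [shift y] and make it a descendant of [shift y]; at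
    equal heights the two coincide, and so do [x] and [y] since [shift] is expanding. *)
Lemma shift_increasing x y : mdist point x = mdist point y ->
  l x < l y -> l (shift x) < l (shift y).
Proof.
move=> xy lxy; rewrite same_first_lt ltNge; apply/negP => le_yx.
have [dx dy] := (first_dom C x, first_dom C y).
have [dx' dy'] := (tc_dom dx, tc_dom dy).
have phixy : phi (l x) <= phi (l y) by apply: tc_mono; lra.
have lx := first_le C' dx'.
have /(_ (phi (l x))) := @between_visits _ _ _ _ _ C' (l' (shift y)) (phi (l y)).
have /andP[ly0 _] := first_dom C' (shift y).
rewrite (first_visit C') ly0 phixy (le_trans le_yx) //.
case/andP: dy' => _ -> /(_ isT isT isT erefl).
rewrite /ancestor -/(shift x) !shift_height xy => e.
have /mdist_positivity eshift : mdist (shift y) (shift x) = 0 by lra.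
have : mdist x y <= 0 by rewrite -(mdistxx (shift x)) -{2}eshift shift_expanding.
rewrite le_eqVlt ltNge mdist_ge0 orbF => /eqP/mdist_positivity exy.
by rewrite exy ltxx in lxy.
Qed.

Lemma iter_shift_height n x : mdist point (iter n shift x) = mdist point x.
Proof. by elim: n => //= n IH; rewrite shift_height. Qed.

Lemma iter_shift_expanding n x y :
  mdist x y <= mdist (iter n shift x) (iter n shift y).
Proof. by elim: n => //= n /le_trans; apply; exact: shift_expanding. Qed.

(** The orbit of [x] is monotone in the order of first visits and stays at one height,
    so its points never come closer to [x] than the first of them. *)
Lemma iter_shift_away k x : mdist x (shift x) <= mdist x (iter k.+1 shift x).
Proof.
have ht n : mdist point x = mdist point (iter n shift x).
  by rewrite iter_shift_height.
apply: first_closer; rewrite ?iter_shift_height ?shift_height //.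
have [lt|gt|eq] := ltgtP (l x) (l (shift x)).
- left => /=.
  have incr n : l (iter n shift x) < l (iter n.+1 shift x).
    by elim: n => //= n IH; apply: shift_increasing; rewrite // -ht shift_height.
  by elim: k => // k /le_trans; apply; exact: ltW (incr k.+1).
- right; rewrite andbT.
  have decr n : l (iter n.+1 shift x) < l (iter n shift x).
    by elim: n => //= n IH; apply: shift_increasing; rewrite // -ht shift_height.
  by elim: k => // k; apply: le_trans; exact: ltW (decr k.+1).
have fix_x : shift x = x.
  by rewrite -[LHS](first_visit C) -eq (first_visit C).
left => /=; rewrite fix_x; suff -> : iter k shift x = x by rewrite fix_x lexx.
by elim: k => //= k ->; exact: fix_x.
Qed.

Hypothesis cT : compact [set: T].

Lemma shift_id x : shift x = x.
Proof.
apply/eqP/negPn/negP; rewrite eq_sym -mdist_gt0 => d0.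
have [n [m [nm]]] := compact_recurrence (fun n => iter n shift x) cT d0.
apply/negP; rewrite -leNgt.
have -> : m = (n + (m - n.+1).+1)%N by rewrite addnS -addSn subnKC.
rewrite iterD; apply: le_trans (iter_shift_expanding n _ _).
exact: iter_shift_away.
Qed.

(** With [y := p' (phi t)], the time [phi (l y)] is another visit of [y] by [p'] since
    [shift y = y]. So [t] and [l y] have images at distance 0, and [p t = p (l y)]. *)
Lemma tc_visit t : 0 <= t <= M -> p' (phi t) = p t.
Proof.
move=> dt; set y := p' (phi t); apply/esym/mdist_positivity/eqP.
rewrite eq_le mdist_ge0 andbT -(first_visit C y).
apply: le_trans (tc_expanding dt (first_dom C y)) _.
by rewrite -/(shift y) shift_id mdistxx.
Qed.

Lemma tc_first x : l' x <= phi (l x).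
Proof.
have dx := first_dom C x; rewrite -[in l' x](first_visit C x) -tc_visit //.
by apply: (first_le C'); exact: tc_dom.
Qed.

(** * Jumps and discrepancies of time-changes *)

Lemma tc_first_gap t y : 0 <= t <= M -> phi t < l' y -> t < l y.
Proof.
move=> /andP[t0 tM] lt; rewrite ltNge; apply/negP => lyt.
have /andP[ly0 _] := first_dom C y.
have := tc_first y; have : phi (l y) <= phi t by apply: tc_mono; rewrite ?lyt.
by lra.
Qed.

(** A point [y] discovered by [p'] in the jump would be discovered by [p] after [t];
    at a time [s] between [t] and [l y], [p'] at [phi s] is between two visits of [y], so
    that [p s] would be a descendant of [y] visited by [p] before [y]. *)
Lemma tc_jump t w : 0 <= t < M -> phi t < w <= M' ->
  (forall s, t < s <= M -> w <= phi s) ->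
  forall u, phi t <= u <= w -> p' u = p t.
Proof.
move=> /andP[t0 tM] /andP[tw wM] ge_w u /andP[tu uw].
have dt : 0 <= t <= M by lra.
have /andP[phit0 phitM] := tc_dom dt.
rewrite -(tc_visit dt).
apply: (coding_gap C' (a := phi t) (b := w)) => //; last first.
- by rewrite uw andbT (le_trans _ tu) // (first_le C') // phit0.
- move=> y /andP[ty yw]; have ly := tc_first_gap dt ty.
  have dy := first_dom C y; pose s := (t + l y) / 2.
  have [ts sy] : t < s /\ s < l y by rewrite /s; split; lra.
  have ds : 0 <= s <= M by lra.
  have ws : w <= phi s by apply: ge_w; lra.
  have sy' : phi s <= phi (l y) by apply: tc_mono; lra.
  have /andP[_ yM] := tc_dom dy.
  have := @first_le_between y (phi s) (phi (l y)).
  rewrite sy' (le_trans (ltW yw)) // !tc_visit // (first_visit C).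
  by move=> /(_ isT yM erefl); have := first_le C ds; lra.
by rewrite phit0.
Qed.

End Visits.

Hypothesis cT : compact [set: T].

(** Same reason as for a jump: if [p'] discovered [y] in the window, then at time
    [psi t] it would be between two visits of [y], so [p t] would descend from [y],
    although [p] discovers [y] after [t]. *)
Lemma tc_between phi psi t : time_change M h h' phi -> time_change M h h' psi ->
  0 <= t <= M -> phi t < psi t -> forall u, phi t <= u <= psi t -> p' u = p t.
Proof.
move=> tc1 tc2 dt lt u /andP[tu ut].
have /andP[phit0 phitM] := tc_dom tc1 dt.
have /andP[_ psitM] := tc_dom tc2 dt.
rewrite -(tc_visit tc1 cT dt).
apply: (coding_gap C' (a := phi t) (b := psi t)) => //; last first.
- by rewrite ut andbT (le_trans _ tu) // (first_le C') // phit0.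
- move=> y /andP[ty yw]; have ly := tc_first_gap tc1 cT dt ty.
  have dy := first_dom C y.
  have sy' : psi t <= psi (l y) by apply: (tc_mono tc2); lra.
  have /andP[_ yM] := tc_dom tc2 dy.
  have := @first_le_between y (psi t) (psi (l y)).
  rewrite sy' (ltW yw) !(tc_visit tc2) // (first_visit C).
  by move=> /(_ isT yM erefl); have := first_le C dt; lra.
by rewrite phit0.
Qed.

(** The window [[phi t, psi t]] is a pause of [p']. By left-continuity [phi t < psi s]
    for [s] slightly before [t], so that the windows at these times all contain
    [phi t]: the contour [p] pauses as well. *)
Lemma tc_unique_lt phi psi t : time_change M h h' phi -> time_change M h h' psi ->
  0 <= t <= M -> phi t < psi t ->
  mu [set p t] <> 0%E /\ mu' [set p t] <> 0%E.
Proof.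
move=> tc1 tc2 dt lt.
have /andP[phit0 phitM] := tc_dom tc1 dt.
have /andP[_ psitM] := tc_dom tc2 dt.
split; last first.
  apply: (coding_atom C' (a := phi t) (b := psi t)); rewrite ?phit0 //.
  exact: tc_between.
have t0 : 0 < t.
  rewrite lt_neqAle; case/andP: dt => -> _; rewrite andbT.
  apply/negP => /eqP t0; move: lt; rewrite -t0.
  by case: tc1 tc2 => [_ _ -> _ _] [_ _ -> _ _]; rewrite ltxx.
case: (tc2) => _ /(_ t) + _ _ _; rewrite in_itv /= t0; case/andP: (dt) => _ tM.
move=> /(_ tM)/cvg_at_leftE/(_ (psi t - phi t)); rewrite subr_gt0 => /(_ lt)[a lt_at ha].
pose b := (Num.max a 0 + t) / 2.
have [ab b0 bt] : [/\ a < b, 0 < b & b < t].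
  by rewrite /b; case: (leP a 0) => ?; split; lra.
apply: (coding_atom C (a := b) (b := t)); rewrite ?(ltW b0) // => s /andP[bs st].
have ds : 0 <= s <= M by lra.
have phist : phi s <= phi t by apply: (tc_mono tc1); lra.
have lt' : phi t < psi s.
  move: st; rewrite le_eqVlt => /orP[/eqP->//|st].
  by have := ha s; rewrite (lt_le_trans ab) // st => /(_ isT); rewrite ltr_distl; lra.
rewrite -(tc_between tc1 tc2 ds (le_lt_trans phist lt') (u := phi t)); last by lra.
by rewrite (tc_visit tc1).
Qed.

Lemma tc_increasing phi s t : time_change M h h' phi ->
  (forall x, mu [set x] = 0%E) -> 0 <= s -> s < t <= M -> phi s < phi t.
Proof.
move=> tc na s0 /andP[st tM]; rewrite ltNge; apply/negP => ts.
apply: (coding_atom C (x := p s) (a := s) (b := t)) (na (p s)); rewrite ?s0 // => u su.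
rewrite -!(tc_visit tc cT); [|lra|lra]; congr p'.
have [su' ut'] : phi s <= phi u /\ phi u <= phi t by split; apply: (tc_mono tc); lra.
by lra.
Qed.

(** A jump of [phi] would be a pause of [p']. *)
Lemma tc_right_cont phi t : time_change M h h' phi ->
  (forall x, mu' [set x] = 0%E) -> 0 <= t < M -> phi x @[x --> t^'+] --> phi t.
Proof.
move=> tc na /andP[t0 tM]; apply/cvg_at_rightE => e e0.
(* Otherwise [phi] skips the window [[phi t, phi t + e]]. *)
have [b [tb bM phib]] : exists b, [/\ t < b, b <= M & phi b < phi t + e].
  apply: contrapT => none.
  have ge_w s : t < s <= M -> phi t + e <= phi s.
    move=> /andP[ts sM]; rewrite leNgt; apply/negP => ?.
    by apply: none; exists s.
  have dM : 0 <= M <= M by lra.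
  have wM : phi t + e <= M'.
    by have /andP[_] := tc_dom tc dM; apply: le_trans; apply: ge_w; lra.
  have /andP[phit0 _] := tc_dom tc (ltac:(lra) : 0 <= t <= M).
  apply: (coding_atom C' (x := p t) (a := phi t) (b := phi t + e)) (na (p t)) => //.
    by rewrite phit0; lra.
  by apply: (tc_jump tc cT) ge_w; lra.
exists b => // s /andP[ts sb].
have [ts' sb'] : phi t <= phi s /\ phi s <= phi b by split; apply: (tc_mono tc); lra.
by rewrite ltr_distl; lra.
Qed.

Lemma tc_continuous phi : time_change M h h' phi ->
  (forall x, mu' [set x] = 0%E) -> {within `[0, M], continuous phi}.
Proof.
move=> tc na; have := height_dom_ge0 (heightP h); rewrite le_eqVlt => /orP[/eqP<-|M0].
  by rewrite set_itv1; exact: continuous_subspace1.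
case: (tc) => _ lcont _ _ _.
apply/continuous_within_itvP => //; split.
- move=> t; rewrite in_itv /= => /andP[t0 tM]; apply/left_right_continuousP; split.
    by apply: lcont; rewrite in_itv /= t0 ltW.
  by apply: tc_right_cont => //; rewrite ltW.
- by apply: tc_right_cont => //; rewrite lexx.
- by apply: lcont; rewrite in_itv /= M0 lexx.
Qed.

Lemma tc_flat phi t u : time_change M h h' phi -> 0 <= t < M ->
  phi t < lim (phi x @[x --> t^'+]) ->
  phi t <= u <= lim (phi x @[x --> t^'+]) -> h' u = h t.
Proof.
move=> tc /andP[t0 tM]; set A := [set phi x | x in `]t, M]%classic].
have dt : 0 <= t <= M by lra.
have lbA : has_lbound A.
  exists 0 => y [s]; rewrite /= in_itv /= => /andP[ts sM] <-.
  by have /andP[] : 0 <= phi s <= M' by apply: (tc_dom tc); lra.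
have lim_w : phi x @[x --> t^'+] --> inf A.
  apply: nondecreasing_at_right_cvgr => //.
  move=> r s; rewrite !in_itv /= => r0 s0 rs.
  by apply: (tc_mono tc); lra.
rewrite (cvg_lim _ lim_w) // => tw tuw.
have ge_w s : t < s <= M -> inf A <= phi s.
  by move=> ts; apply: ge_inf => //; exists s; rewrite //= in_itv.
have dM : 0 <= M <= M by lra.
have wM : inf A <= M'.
  by have /andP[_] := tc_dom tc dM; apply: le_trans; apply: ge_w; lra.
have pu : p' u = p t by apply: (tc_jump tc cT) ge_w u tuw; lra.
have /andP[phit0 _] := tc_dom tc dt.
rewrite -(dist_root C dt) -pu (dist_root C') //; lra.
Qed.

(** * Construction of time-changes *)

(** The least time-change. The value 0 is thrown in to deal with [t = 0], before
    which nothing is visited. *)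
Definition first_sup t : R :=
  sup [set u | u = 0 \/ exists2 x, l x < t & u = l' x].

Lemma first_sup_ub t x : l x < t -> l' x <= first_sup t.
Proof.
move=> xt; apply: ub_le_sup; last by right; exists x.
exists M' => _ [->|[y _ ->]]; first by case/andP: (dom0 h').
by case/andP: (first_dom C' y).
Qed.

Lemma first_sup_le t c : 0 <= c -> (forall x, l x < t -> l' x <= c) ->
  first_sup t <= c.
Proof.
move=> c0 xc; apply: ge_sup; first by exists 0; left.
by move=> _ [->|[x xt ->]] //; exact: xc.
Qed.

Lemma first_sup_ge0 t : 0 <= first_sup t.
Proof.
apply: ub_le_sup; last by left.
exists M' => _ [->|[y _ ->]]; first by case/andP: (dom0 h').
by case/andP: (first_dom C' y).
Qed.

Lemma first_sup_gt t u : 0 <= u < first_sup t -> exists2 x, l x < t & u < l' x.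
Proof.
move=> /andP[u0 ut]; apply: contrapT => none.
move: ut; rewrite ltNge => /negP; apply; apply: first_sup_le => // x xt.
by rewrite leNgt; apply/negP => ux; apply: none; exists x.
Qed.

Lemma first_sup_dom t : 0 <= first_sup t <= M'.
Proof.
rewrite first_sup_ge0 first_sup_le ?(height_dom_ge0 (heightP h')) // => x _.
by case/andP: (first_dom C' x).
Qed.

Lemma first_sup_max t x : l x < t -> (forall y, l y < t -> l y <= l x) ->
  first_sup t = l' x.
Proof.
move=> xt xmax; apply/eqP; rewrite eq_le first_sup_ub // andbT.
apply: first_sup_le; first by case/andP: (first_dom C' x).
by move=> y /xmax; rewrite !leNgt same_first_lt.
Qed.

Lemma first_sup0 : first_sup 0 = 0.
Proof.
apply/eqP; rewrite eq_le first_sup_ge0 first_sup_le // => x.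
by rewrite ltNge; case/andP: (first_dom C x) => ->.
Qed.

(** If [p] last discovered [x] before [t], it pauses at [x] until [t] by the gap
    property. Otherwise discoveries accumulate at [t] and, their order being common to
    both contours, their times for [p'] accumulate at [first_sup t]; left-continuity
    of [p] and [p'] identifies the limits. *)
Lemma first_sup_visit t : 0 <= t <= M -> p' (first_sup t) = p t.
Proof.
move=> /andP[]; rewrite le_eqVlt => /orP[/eqP<- _|t0 tM].
  by rewrite first_sup0 (contour_root C) (contour_root C').
have [[x [xt xmax]]|nomax] :=
    pselect (exists x, l x < t /\ forall y, l y < t -> l y <= l x).
  rewrite (first_sup_max xt xmax) (first_visit C') -[LHS](first_visit C x).
  have /andP[x0 xM] := first_dom C x.
  apply/esym/(coding_gap C (a := l x) (b := t)); rewrite ?x0 //.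
    by move=> y /andP[xy /xmax]; rewrite leNgt xy.
  by rewrite (first_visit C) lexx ltW.
have above x : l x < t -> exists2 y, l x < l y & l y < t.
  move=> xt; apply: contrapT => none; apply: nomax; exists x; split=> // y yt.
  by rewrite leNgt; apply/negP => xy; apply: none; exists y.
have after a : 0 <= a < t -> exists2 x, a < l x & l x < t.
  move=> /andP[a0 lt_at]; apply: contrapT => none.
  have pa u : l (p a) <= u <= t -> p u = p a.
    apply: (coding_gap C (b := t)); rewrite ?a0 // => x /andP[ax xt].
    by apply: none; exists x.
  have ta : l (p a) < t by apply: (le_lt_trans _ lt_at); apply: (first_le C); lra.
  have [y ay yt] := above _ ta.
  have := pa (l y); rewrite !ltW // (first_visit C) => /(_ isT) ey.
  by rewrite ey ltxx in ay.
have pos : 0 < first_sup t.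
  have [x x0 xt] := after 0 ltac:(by rewrite lexx).
  have [y xy yt] := above x xt.
  apply: lt_le_trans (first_sup_ub yt); rewrite same_first_lt in xy.
  by apply: le_lt_trans xy; case/andP: (first_dom C' x).
apply/eqP/negPn/negP; rewrite -mdist_gt0; set d := mdist _ _ => d0.
have [a /andP[a0 lt_at] ha] :=
  contour_left_cont C (t := t) (e := d / 2) ltac:(by rewrite t0) ltac:(lra).
have [a' /andP[a'0 a't] ha'] := contour_left_cont C' (t := first_sup t) (e := d / 2)
  ltac:(by rewrite pos; case/andP: (first_sup_dom t)) ltac:(lra).
(* The later of two discoveries, one close to [t], the other to [first_sup t]. *)
suff [z [az zt a'z]] : exists z, [/\ a < l z, l z < t & a' < l' z].
  have := ha (l z); have := ha' (l' z).
  rewrite a'z first_sup_ub // az (ltW zt) => /(_ isT) d1 /(_ isT) d2.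
  rewrite (first_visit C) in d2; rewrite (first_visit C') in d1.
  have := metric_triangle (p' (first_sup t)) z (p t).
  by rewrite (metric_sym (p' _) z) -/d; lra.
have [x ax xt] := after a ltac:(by rewrite a0).
have [y yt a'y] := first_sup_gt (ltac:(by rewrite a'0) : 0 <= a' < first_sup t).
have [xy|yx] := ltP (l x) (l y).
  by exists y; split=> //; lra.
exists x; split=> //; apply: lt_le_trans a'y _.
by move: yx; rewrite !leNgt same_first_lt.
Qed.

Lemma first_sup_time_change : time_change M h h' first_sup.
Proof.
split=> [s t _ _ st|t||t _|t].
- apply: first_sup_le; first exact: first_sup_ge0.
  by move=> x xs; apply: first_sup_ub; exact: lt_le_trans st.
- rewrite in_itv /= => /andP[t0 tM]; apply/cvg_at_leftE => e e0.
  have mono s : s < t -> first_sup s <= first_sup t.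
    move=> st; apply: first_sup_le; first exact: first_sup_ge0.
    by move=> x xs; apply: first_sup_ub; exact: lt_trans st.
  have [small|big] := ltP (first_sup t - e) 0.
    exists 0 => // s /andP[s0 st]; rewrite ltr_distl.
    by have := first_sup_ge0 s; have := mono s st; lra.
  have [|x xt ex] := @first_sup_gt t (first_sup t - e); first by rewrite big; lra.
  exists (l x) => // s /andP[xs st]; rewrite ltr_distl.
  by have := first_sup_ub xs; have := mono s st; lra.
- exact: first_sup0.
- by rewrite in_itv /= first_sup_dom.
rewrite in_itv /= => dt.
by rewrite -(dist_root C dt) -first_sup_visit // (dist_root C') ?first_sup_dom.
Qed.

(** Let both contours pause at [x], until [b] and [b'] respectively. The least
    time-change stays at [l' x] during the pause of [p]; raising it to [b'] after
    [l x] changes only the moment at which the pause of [p'] is entered. *)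
Lemma tc_not_unique x : mu [set x] <> 0%E -> mu' [set x] <> 0%E ->
  exists phi psi, [/\ time_change M h h' phi, time_change M h h' psi &
    exists2 t, 0 <= t <= M & phi t <> psi t].
Proof.
move=> /(coding_atom_itv C)[b [/andP[xb bM] pb]].
move=> /(coding_atom_itv C')[b' [/andP[xb' bM'] pb']].
have /andP[lx0 _] := first_dom C x; have /andP[lx0' _] := first_dom C' x.
have [mono lcont at0 dom eqh] := first_sup_time_change.
pose psi t := Num.max (first_sup t) (if t <= l x then 0 else b').
exists first_sup, psi; split; first exact: first_sup_time_change.
  split=> [s t ds dt st|t||t dt|t dt].
  - rewrite /psi ge_max !le_max mono //=.
    have [sx|xs] := leP s (l x); first by rewrite first_sup_ge0.
    by rewrite [t <= l x]leNgt (lt_le_trans xs st) /= lexx orbT.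
  - move=> dt; apply/cvg_at_leftE => e e0.
    have /cvg_at_leftE/(_ e e0)[a lt_at ha] := lcont t dt.
    have [tx|xt] := leP t (l x).
      exists a => // s /andP[a_s st].
      rewrite /psi tx (le_trans (ltW st) tx) !max_l ?first_sup_ge0 //.
      by apply: ha; rewrite a_s.
    exists (Num.max a (l x)); first by rewrite gt_max lt_at.
    move=> s; rewrite gt_max => /andP[/andP[a_s xs] st].
    have := ha s; rewrite a_s st => /(_ isT).
    rewrite /psi [s <= l x]leNgt [t <= l x]leNgt xs xt /= !ltr_distl.
    by case: (leP (first_sup t) b'); case: (leP (first_sup s) b'); lra.
  - by rewrite /psi lx0 max_l // at0.
  - have := first_sup_dom t; rewrite in_itv /= /psi.
    by case: ifP => _; [case: (leP (first_sup t) 0)|case: (leP (first_sup t) b')]; lra.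
  rewrite /psi; have [tx|xt] := leP t (l x); first by rewrite max_l ?first_sup_ge0 ?eqh.
  have := first_sup_ub xt.
  have [tb'|bt'] := leP (first_sup t) b'; last by rewrite eqh.
  move=> xt'; rewrite in_itv /= in dt.
  rewrite -(dist_root C dt) -first_sup_visit // pb' ?xt' //.
  rewrite -(dist_root C') ?pb' ?lexx ?(ltW xb') //; lra.
exists b; first by lra.
rewrite /psi [b <= l x]leNgt xb /= (first_sup_max xb) ?max_r ?ltW //.
  by move=> e; rewrite e ltxx in xb'.
move=> y yb; rewrite leNgt; apply/negP => xy.
have := pb (l y); rewrite !ltW // (first_visit C) => /(_ isT) ey.
by rewrite ey ltxx in xy.
Qed.

End TimeChange.

(** * The time-change theorem *)

Theorem theorem1p3 (R : realType) (T : rootedMetricType R) (le : rel T)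
    (mu mu' : {finite_measure set (borel T) -> \bar R}) (h h' : height R)
    (hT : compact_real_tree T) (hle : linear_order le)
    (h1 : Or1 le) (h2 : Or2 le) (hmu : Mes le mu) (hmu' : Mes le mu')
    (hh : codes h le mu) (hh' : codes h' le mu') :
  (exists phi : R -> R, time_change (fine (mu setT)) h h' phi) /\
  ((forall phi psi : R -> R, time_change (fine (mu setT)) h h' phi ->
      time_change (fine (mu setT)) h h' psi -> {in `[0, fine (mu setT)], phi =1 psi}) <->
   (forall x : T, mu [set x] * mu' [set x] = 0)%E) /\
  (forall phi : R -> R, time_change (fine (mu setT)) h h' phi ->
    [/\ (forall x : T, mu' [set x] = 0%E) ->
          {within `[0, fine (mu setT)], continuous phi},
        (forall x : T, mu [set x] = 0%E) ->
          {in `[0, fine (mu setT)] &, {homo phi : s t / s < t}} &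
        forall t, t \in `[0, zeta h[ ->
          phi t < lim (phi x @[x --> t^'+]) ->
          forall u, u \in `[phi t, lim (phi x @[x --> t^'+])] ->
            h' u = h t]).
Proof.
have [p [l C]] := codes_coding hle hh.
have [p' [l' C']] := codes_coding hle hh'.
have cT := hT.2.
rewrite (coding_mass C) /=; split; first by eexists; exact: first_sup_time_change C C'.
split; [split=> [uniq x|no_shared phi psi tc1 tc2 t] | move=> phi tc; split].
- apply/eqP; rewrite mule_eq0; apply/negPn/negP; rewrite negb_or => /andP[/eqP mx /eqP mx'].
  have [phi [psi [tc1 tc2 [t dt]]]] := tc_not_unique C C' mx mx'.
  by apply; apply: uniq => //; rewrite in_itv.
- rewrite in_itv /= => dt.
  have contra : ~ (mu [set p t] <> 0%E /\ mu' [set p t] <> 0%E).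
    by move=> [mx mx']; have /eqP := no_shared (p t); rewrite mule_eq0 => /orP[] /eqP.
  have [lt|gt|//] := ltgtP (phi t) (psi t); case: contra.
    exact: (tc_unique_lt C C' cT tc1 tc2).
  exact: (tc_unique_lt C C' cT tc2 tc1).
- exact: (tc_continuous C C' cT tc).
- move=> na s t; rewrite !in_itv /= => /andP[s0 sM] /andP[t0 tM] st.
  by apply: (tc_increasing C C' cT tc) => //; rewrite st.
- move=> t; rewrite in_itv /= => dt lt u; rewrite in_itv /=.
  exact: (tc_flat C C' cT tc).
Qed.
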